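(* Let $C$ be a special spacelike Frenet curve in $E_1^4$, parametrized by arc length $\mathbf c:L\to E_1^4$, with Frenet frame $\{\mathbf e_1,\mathbf e_2,\mathbf e_3,\mathbf e_4\}$, whose curvature functions $k_1$ and $k_2$ are non-constant functions and satisfy $$k_1(s)=-\alpha\left(\mu_1k_1^2(s)+\mu_2k_2^2(s)\right)\quad\text{for all } s\in L,$$ where $\alpha$ is a non-zero constant. If the spacelike curve $C^*$ given by $$\mathbf c^*(s)=\mathbf c(s)+\alpha\,\mathbf e_2(s),\quad s\in L,$$ is a special spacelike Frenet curve, then $C^*$ is a generalized spacelike Mannheim mate curve of $C$.
   Context: Minkowski space-time $E_1^4$ is $\mathbb R^4$ with the metric $\langle x,y\rangle=-x_1y_1+x_2y_2+x_3y_3+x_4y_4$, and $\|v\|=\sqrt{|\langle v,v\rangle|}$. A vector $v$ is spacelike if $\langle v,v\rangle>0$ or $v=0$, timelike if $\langle v,v\rangle<0$, null if $\langle v,v\rangle=0$ and $v\neq0$. All curves are regular $C^\infty$ curves whose velocity vectors are spacelike; $L\subset\mathbb R$ is an interval, and $\mathbf c:L\to E_1^4$ is an arc-length parametrization if $\langle\mathbf c'(s),\mathbf c'(s)\rangle=1$ for all $s\in L$. Special spacelike Frenet curve: a spacelike curve $C$ with arc-length parametrization $\mathbf c:L\to E_1^4$ admitting smooth functions $k_1>0$, $k_2>0$, $k_3$ (nowhere zero) on $L$ and a smooth, positively oriented (determinant $+1$), orthonormal frame $\{\mathbf e_1,\mathbf e_2,\mathbf e_3,\mathbf e_4\}$ of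 non-null vector fields along $C$, with $\mathbf e_1=\mathbf c'$ and $$\mathbf e_1'=k_1\mathbf e_2,\quad \mathbf e_2'=\mu_1k_1\mathbf e_1+k_2\mathbf e_3,\quad \mathbf e_3'=\mu_2k_2\mathbf e_2+k_3\mathbf e_4,\quad \mathbf e_4'=\mu_3k_3\mathbf e_3.$$ Exactly one of $\mathbf e_2,\mathbf e_3,\mathbf e_4$ is timelike (with $\langle\mathbf e_i,\mathbf e_i\rangle=-1$), the other frame vectors being spacelike unit vectors, and: if $\mathbf e_4$ is timelike, $(\mu_1,\mu_2,\mu_3)=(-1,-1,1)$; if $\mathbf e_3$ is timelike, $(\mu_1,\mu_2,\mu_3)=(-1,1,1)$; if $\mathbf e_2$ is timelike, $(\mu_1,\mu_2,\mu_3)=(1,1,-1)$. The functions $k_1,k_2,k_3$ are the first, second and third curvature functions. In particular $k_1=\|\mathbf e_1'\|$ and $k_2=\|\mathbf e_2'-\mu_1k_1\mathbf e_1\|$. The lines through a point of $C$ in the directions of $\mathbf e_2,\mathbf e_3,\mathbf e_4$ are the first, second and third normal lines of $C$ at that point. The parameter $s$ of $C$ need not be arc length on $C^*$; saying that $C^*$ is a special spacelike Frenet curve, and speaking of its frame $\{\mathbf e_1^*,\dots,\mathbf e_4^*\}$ and normal lines, refers to its arc-length parameter $s^*=f(s)=\int_0^s\|d\mathbf c^*/ds\|\,ds$. Generalized spacelike Mannheim mate curve of $C$: a special spacelike Frenet curve $C^*$ together with a bijection $\phi:C\to C^*$ such that at each point of $C$ the first normal line of $C$ is included in the plane generated by the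 second and third normal lines of $C^*$ at the corresponding point under $\phi$. Here the bijection is $\phi(\mathbf c(s))=\mathbf c^*(s)$. *)

(* Defs.v *)
From HB Require Import structures.
From mathcomp Require Import all_boot all_order all_algebra.
From mathcomp Require Import all_classical all_reals all_analysis.
Import Order.TTheory GRing.Theory Num.Theory.
Import numFieldNormedType.Exports.

Set Implicit Arguments.
Unset Strict Implicit.
Unset Printing Implicit Defensive.

Local Open Scope classical_set_scope.
Local Open Scope ring_scope.

(* Calculus on an interval L that may contain its endpoints: all limits are
   taken within L, so derivatives at endpoints of L are one-sided. *)

Definition diff_quotient (R : realType) (V : normedModType R)
    (f : R -> V) (s : R) : R -> V :=
  fun t => (t - s)^-1 *: (f t - f s).

Definition derivable_in (R : realType) (V : normedModType R)
    (L : set R) (f : R -> V) (s : R) : Prop :=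
  cvg (diff_quotient f s @ within L s^').

Definition derive_in (R : realType) (V : normedModType R)
    (L : set R) (f : R -> V) (s : R) : V :=
  lim (diff_quotient f s @ within L s^').

Definition smooth_on (R : realType) (V : normedModType R)
    (L : set R) (f : R -> V) : Prop :=
  forall (n : nat) (s : R), L s -> derivable_in L (iter n (derive_in L) f) s.

Definition nondegenerate_interval (R : realType) (L : set R) : Prop :=
  is_interval L /\ exists s t : R, [/\ L s, L t & s < t].

Definition constant_on (R : realType) (L : set R) (f : R -> R) : Prop :=
  exists a : R, forall s, L s -> f s = a.

(* Coordinates are numbered from 0, so the timelike coordinate x_1 of E_1^4
   is x 0 0. *)
Definition mink (R : realType) (x y : 'rV[R]_4) : R :=
  - (x 0 0 * y 0 0) + x 0 1 * y 0 1 + x 0 2 * y 0 2 + x 0 3 * y 0 3.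

Definition mink_norm (R : realType) (v : 'rV[R]_4) : R :=
  Num.sqrt `|mink v v|.

Definition spacelike (R : realType) (v : 'rV[R]_4) : Prop :=
  0 < mink v v \/ v = 0.

Definition spacelike_curve (R : realType) (L : set R) (c : R -> 'rV[R]_4) :
    Prop :=
  [/\ nondegenerate_interval L, smooth_on L c &
      forall s, L s -> spacelike (derive_in L c s) /\ derive_in L c s != 0].

(* int_{s0}^s ||dc/ds|| ds, as an oriented integral *)
Definition arc_length (R : realType) (L : set R) (c : R -> 'rV[R]_4)
    (s0 s : R) : R :=
  if s0 <= s
  then \int[lebesgue_measure]_(t in `[s0, s]) mink_norm (derive_in L c t)
  else - \int[lebesgue_measure]_(t in `[s, s0]) mink_norm (derive_in L c t).

Variant timelike_normal := Timelike2 | Timelike3 | Timelike4.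

Definition timelike_index (w : timelike_normal) : 'I_4 :=
  match w with Timelike2 => 1 | Timelike3 => 2 | Timelike4 => 3 end.

Definition frame_sign (R : realType) (w : timelike_normal) (i : 'I_4) : R :=
  if i == timelike_index w then -1 else 1.

Definition mu1 (R : realType) (w : timelike_normal) : R :=
  match w with Timelike2 => 1 | Timelike3 => -1 | Timelike4 => -1 end.
Definition mu2 (R : realType) (w : timelike_normal) : R :=
  match w with Timelike2 => 1 | Timelike3 => 1 | Timelike4 => -1 end.
Definition mu3 (R : realType) (w : timelike_normal) : R :=
  match w with Timelike2 => -1 | Timelike3 => 1 | Timelike4 => 1 end.

(* Only the values of the functions on [domain] are meaningful. *)
Record frenet_data (R : realType) := FrenetData {
  domain : set R;
  curve : R -> 'rV[R]_4;
  e1 : R -> 'rV[R]_4;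
  e2 : R -> 'rV[R]_4;
  e3 : R -> 'rV[R]_4;
  e4 : R -> 'rV[R]_4;
  k1 : R -> R;
  k2 : R -> R;
  k3 : R -> R;
  causal : timelike_normal
}.

Definition frame (R : realType) (C : frenet_data R) (s : R) :
    4.-tuple 'rV[R]_4 :=
  [tuple e1 C s; e2 C s; e3 C s; e4 C s].

Record special_frenet (R : realType) (C : frenet_data R) : Prop := {
  sf_curve : spacelike_curve (domain C) (curve C);
  sf_arc_length : forall s, domain C s ->
    mink (derive_in (domain C) (curve C) s)
         (derive_in (domain C) (curve C) s) = 1;
  sf_smooth_frame : [/\ smooth_on (domain C) (e1 C),
    smooth_on (domain C) (e2 C), smooth_on (domain C) (e3 C) &
    smooth_on (domain C) (e4 C)];
  sf_smooth_curvatures : [/\ smooth_on (domain C) (k1 C : R -> R^o),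
    smooth_on (domain C) (k2 C : R -> R^o) &
    smooth_on (domain C) (k3 C : R -> R^o)];
  sf_curvatures : forall s, domain C s ->
    [/\ 0 < k1 C s, 0 < k2 C s & k3 C s != 0];
  sf_orthonormal : forall s, domain C s -> forall i j : 'I_4,
    mink (tnth (frame C s) i) (tnth (frame C s) j) =
    if i == j then frame_sign R (causal C) i else 0;
  sf_oriented : forall s, domain C s ->
    \det (\matrix_(i < 4) tnth (frame C s) i) = 1;
  sf_tangent : forall s, domain C s ->
    e1 C s = derive_in (domain C) (curve C) s;
  sf_frenet1 : forall s, domain C s ->
    derive_in (domain C) (e1 C) s = k1 C s *: e2 C s;
  sf_frenet2 : forall s, domain C s ->
    derive_in (domain C) (e2 C) s =
    (mu1 R (causal C) * k1 C s) *: e1 C s + k2 C s *: e3 C s;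
  sf_frenet3 : forall s, domain C s ->
    derive_in (domain C) (e3 C) s =
    (mu2 R (causal C) * k2 C s) *: e2 C s + k3 C s *: e4 C s;
  sf_frenet4 : forall s, domain C s ->
    derive_in (domain C) (e4 C) s = (mu3 R (causal C) * k3 C s) *: e3 C s
}.

(* D is the curve c on L, rewritten in terms of its arc-length parameter
   measured from s0. *)
Definition arc_length_form (R : realType) (L : set R) (c : R -> 'rV[R]_4)
    (s0 : R) (D : frenet_data R) : Prop :=
  domain D = arc_length L c s0 @` L /\
  forall s, L s -> curve D (arc_length L c s0 s) = c s.

Definition first_normal_line (R : realType) (C : frenet_data R) (s : R) :
    set 'rV[R]_4 :=
  [set x | exists t : R, x = curve C s + t *: e2 C s].

(* the affine plane through the point of C generated by its second and third
   normal lines *)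
Definition normal_plane23 (R : realType) (C : frenet_data R) (s : R) :
    set 'rV[R]_4 :=
  [set x | exists a b : R, x = curve C s + a *: e3 C s + b *: e4 C s].

(* Since the curves may have self-intersections, a point of a curve is
   understood as a value of its arc-length parameter, and phi : C -> C* as a
   bijection between the two parameter intervals. *)
Definition generalized_mannheim_mate (R : realType) (C Cstar : frenet_data R)
    (phi : R -> R) : Prop :=
  [/\ special_frenet C, special_frenet Cstar,
      set_bij (domain C) (domain Cstar) phi &
      forall s, domain C s ->
        first_normal_line C s `<=` normal_plane23 Cstar (phi s)].

(* Main.v *)
Require Import Defs.
From HB Require Import structures.
From mathcomp Require Import all_boot all_order all_algebra.
From mathcomp Require Import all_classical all_reals all_analysis.
From mathcomp Require Import ring lra.
Import Order.TTheory GRing.Theory Num.Theory.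
Import numFieldNormedType.Exports.
Local Open Scope classical_set_scope.
Local Open Scope ring_scope.

(** Why the theorem holds. Write f for the arc length of C* as a function of
    the parameter of C. Since c*(s) lies on the first normal line of C at
    c(s), that line is contained in the plane through c*(s) spanned by e3* and
    e4* as soon as e2 is a combination of e3* and e4*; as the frame of C* is
    orthonormal, this means that e2 is orthogonal to e1* and e2*
    ([orthogonal_e1_e2_span]).

    The Frenet formulas give the velocity of c* = c + alpha e2,

      f' (e1* o f) = (1 + alpha mu1 k1) e1 + alpha k2 e3,

    which has no e2 component, so e1* o f is orthogonal to e2 along the whole
    curve. Differentiating <e1* o f, e2> = 0 yields

      f' k1* <e2* o f, e2> + <e1* o f, e2'> = 0,

    and, because mu1 <e3, e3> = mu2 and mu1 ^ 2 = 1,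

      f' <e1* o f, e2'> = mu1 (k1 + alpha (mu1 k1 ^ 2 + mu2 k2 ^ 2)),

    which is exactly what the hypothesis on the curvatures makes vanish. As f'
    and k1* are positive, e2 is orthogonal to e2* o f. Differentiating the
    scalar product, rather than the explicit formula for e1*, avoids any
    computation with derivatives of the curvatures or of f'.

    What remains is analysis on an interval L with possible endpoints: limits
    within L are unique ([within_dnbhs_proper]), derivatives within L obey the
    chain rule and the product rule ([has_derive_in_comp],
    [has_derive_in_mink]), and f is a strictly increasing function whose
    derivative is the speed of c* ([arc_length_lt],
    [has_derive_in_arc_length]); the former also makes f the required
    bijection. *)

Set Implicit Arguments.
Unset Strict Implicit.

(** * Differentiation within an interval *)

(** A nondegenerate interval accumulates at each of its points, endpoints
    included; this is what makes derivatives within it unique. *)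
Lemma within_dnbhs_proper (R : realType) (L : set R) (s : R) :
  nondegenerate_interval L -> L s -> ProperFilter (within L s^').
Proof.
move=> [Lint [a [b [La Lb ab]]]] Ls.
apply: Build_ProperFilter => -[e /= e0 He].
have [p Lp ps] : exists2 p, L p & p != s.
  have [as_|] := eqVneq a s; last by exists a.
  by exists b => //; rewrite -as_ gt_eqF.
(* move from s towards p by e / 2, stopping at p if that would overshoot *)
have [t [Lt ts te]] : exists t, [/\ L t, t != s & `|s - t| < e].
  case: (ltgtP p s) ps => // ps _.
  - exists (Num.max p (s - e / 2)); have [h|h] := leP p (s - e / 2).
    + split; [apply: (Lint p s) => //| |]; first lra.
        by rewrite lt_eqF //; lra.
      by rewrite ger0_norm; lra.
    + by split=> //; [rewrite lt_eqF|rewrite ger0_norm; lra].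
  - exists (Num.min p (s + e / 2)); have [h|h] := leP p (s + e / 2).
    + by split=> //; [rewrite gt_eqF|rewrite ltr0_norm; lra].
    + split; [apply: (Lint s p) => //| |]; first lra.
        by rewrite gt_eqF //; lra.
      by rewrite ltr0_norm; lra.
exact: (He t te ts Lt).
Qed.

(** Unlike [derive_in], whose value is arbitrary where the limit does not
    exist, this relation carries differentiability, so that the rules of
    calculus need no separate hypotheses of differentiability. *)
Definition has_derive_in (R : realType) (V : normedModType R)
    (L : set R) (f : R -> V) (s : R) (d : V) : Prop :=
  diff_quotient f s @ within L s^' --> d.

Lemma derivable_inP (R : realType) (V : normedModType R)
    (L : set R) (f : R -> V) (s : R) :
  derivable_in L f s -> has_derive_in L f s (derive_in L f s).
Proof. by []. Qed.

Lemma has_derive_in_unique (R : realType) (V : normedModType R)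
    (L : set R) (f : R -> V) (s : R) (d d' : V) :
  nondegenerate_interval L -> L s ->
  has_derive_in L f s d -> has_derive_in L f s d' -> d = d'.
Proof.
move=> Lnd Ls fd fd'; have PF := within_dnbhs_proper Lnd Ls.
exact: cvg_unique fd fd'.
Qed.

Lemma near_within_dnbhs (R : realType) (L : set R) (s : R) :
  \forall t \near within L s^', L t /\ t != s.
Proof. by rewrite !near_withinE; near=> t => ts Lt. Unshelve. all: by end_near. Qed.

(** Derivatives within L ignore the values taken outside L, which are
    unspecified for all the curves and frames considered here. *)
Lemma eq_has_derive_in (R : realType) (V : normedModType R)
    (L : set R) (f g : R -> V) (s : R) (d : V) :
  L s -> (forall t, L t -> f t = g t) ->
  has_derive_in L f s d -> has_derive_in L g s d.
Proof.
move=> Ls fg; apply: cvg_trans; apply: near_eq_cvg.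
near=> t; have [Lt _] : L t /\ t != s by near: t; exact: near_within_dnbhs.
by rewrite /diff_quotient !fg.
Unshelve. all: by end_near. Qed.

Lemma has_derive_in_cvg (R : realType) (V : normedModType R)
    (L : set R) (f : R -> V) (s : R) (d : V) :
  has_derive_in L f s d -> f t @[t --> within L s^'] --> f s.
Proof.
move=> fd; rewrite -[f s]add0r -[X in X + _](scale0r d).
have ts0 : (t - s) @[t --> within L s^'] --> (0 : R).
  rewrite -(subrr s); apply: cvgB; last exact: cvg_cst.
  by apply: cvg_within_filter; apply: cvg_within_filter; exact: cvg_id.
(* f t = f s + (t - s) * (difference quotient), for t != s *)
apply: cvg_trans (cvgD (cvgZ ts0 fd) (cvg_cst (f s))).
apply: near_eq_cvg; near=> t.
have [_ ts] : L t /\ t != s by near: t; exact: near_within_dnbhs.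
rewrite -[LHS]/((t - s) *: ((t - s)^-1 *: (f t - f s)) + f s).
by rewrite scalerA mulfV ?subr_eq0// scale1r subrK.
Unshelve. all: by end_near. Qed.

Lemma derivable_in_continuous (R : realType) (V : normedModType R)
    (L : set R) (f : R -> V) :
  (forall s, L s -> derivable_in L f s) -> {within L, continuous f}.
Proof.
move=> fd; apply/subspace_continuousP => s Ls.
have := has_derive_in_cvg (derivable_inP (fd _ Ls)).
move=> fs A As.
have h : nbhs s [set t | t != s -> L t -> A (f t)] := fs A As.
apply: filterS h => t h Lt; have [->|ts] := eqVneq t s; last exact: h.
exact: (nbhs_singleton (As : nbhs (f s) A)).
Qed.

Lemma has_derive_inDZ (R : realType) (V : normedModType R) (L : set R)
    (f g : R -> V) (s a : R) (u v : V) :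
  has_derive_in L f s u -> has_derive_in L g s v ->
  has_derive_in L (fun t => f t + a *: g t) s (u + a *: v).
Proof.
move=> fu gv; have h : (fun t => diff_quotient f s t +
    a *: diff_quotient g s t) @ within L s^' --> u + a *: v.
  by apply: cvgD => //; apply: cvgZ => //; exact: cvg_cst.
rewrite /has_derive_in; apply: cvg_trans h; apply: near_eq_cvg; near=> t.
rewrite /diff_quotient [a *: (_ *: _)]scalerA [a * _]mulrC -scalerA -scalerDr.
by rewrite opprD addrACA scalerBr.
Unshelve. all: by end_near. Qed.

(** Injectivity of f at s allows the difference quotient of g o f to be
    factored as that of f times that of g at f t, with no separate treatment of
    the parameters t at which f t = f s. *)
Lemma has_derive_in_comp (R : realType) (V : normedModType R)
    (L : set R) (f : R -> R) (g : R -> V) (s a : R) (b : V) :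
  L s -> (forall t, L t -> t != s -> f t != f s) ->
  has_derive_in L (f : R -> R^o) s a ->
  has_derive_in (f @` L) g (f s) b ->
  has_derive_in L (g \o f) s (a *: b).
Proof.
move=> Ls finj fd gd.
have fs : f t @[t --> within L s^'] --> within (f @` L) (f s)^'.
  move=> A As.
  have h : nbhs s [set t | t != s -> L t ->
      f t != f s -> (f @` L) (f t) -> A (f t)] := has_derive_in_cvg fd As.
  apply: filterS h => t h ts Lt.
  by apply: (h ts Lt (finj _ Lt ts)); exists t.
apply: cvg_trans (cvgZ fd (cvg_comp _ _ fs gd)).
apply: near_eq_cvg; near=> t.
have [Lt ts] : L t /\ t != s by near: t; exact: near_within_dnbhs.
have ft := finj _ Lt ts.
rewrite /= /diff_quotient scalerA; congr (_ *: _).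
by rewrite -[_ *: _]/(_ * _) -mulrA mulfV ?mulr1// subr_eq0.
Unshelve. all: by end_near. Qed.

(** * The Minkowski product *)

Lemma minkC (R : realType) (x y : 'rV[R]_4) : mink x y = mink y x.
Proof. by rewrite /mink; ring. Qed.

Lemma minkDl (R : realType) (x y z : 'rV[R]_4) :
  mink (x + y) z = mink x z + mink y z.
Proof. by rewrite /mink !mxE; ring. Qed.

Lemma minkZl (R : realType) (a : R) (x y : 'rV[R]_4) :
  mink (a *: x) y = a * mink x y.
Proof. by rewrite /mink !mxE; ring. Qed.

Lemma minkDr (R : realType) (x y z : 'rV[R]_4) :
  mink x (y + z) = mink x y + mink x z.
Proof. by rewrite !(minkC x) minkDl. Qed.

Lemma minkZr (R : realType) (a : R) (x y : 'rV[R]_4) :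
  mink x (a *: y) = a * mink x y.
Proof. by rewrite !(minkC x) minkZl. Qed.

Lemma cvg_mink (R : realType) (T : Type) (F : set_system T) {FF : Filter F}
    (f g : T -> 'rV[R]_4) (a b : 'rV[R]_4) :
  f @ F --> a -> g @ F --> b -> mink (f t) (g t) @[t --> F] --> mink a b.
Proof.
move=> fa gb.
have fi i : f t 0 i @[t --> F] --> a 0 i.
  by apply: (cvg_comp f (fun M : 'rV[R]_4 => M 0 i) fa); exact: coord_continuous.
have gi i : g t 0 i @[t --> F] --> b 0 i.
  by apply: (cvg_comp g (fun M : 'rV[R]_4 => M 0 i) gb); exact: coord_continuous.
by do ?[apply: cvgD]; try apply: cvgN; apply: cvgM.
Qed.

Lemma has_derive_in_mink (R : realType) (L : set R) (f g : R -> 'rV[R]_4)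
    (s : R) (a b : 'rV[R]_4) :
  has_derive_in L f s a -> has_derive_in L g s b ->
  has_derive_in L (fun t => mink (f t) (g t) : R^o) s
    (mink a (g s) + mink (f s) b).
Proof.
move=> fa gb.
have fs : (fun=> f s) @ within L s^' --> f s by exact: cvg_cst.
have h : (fun t => mink (diff_quotient f s t) (g t) +
      mink (f s) (diff_quotient g s t) : R^o) @ within L s^' -->
    (mink a (g s) + mink (f s) b : R^o).
  by apply: cvgD; apply: cvg_mink => //; exact: has_derive_in_cvg gb.
rewrite /has_derive_in; apply: cvg_trans h; apply: near_eq_cvg; near=> t.
(* <f t, g t> - <f s, g s> = <f t - f s, g t> + <f s, g t - g s> *)
rewrite /= /diff_quotient -[_ *: _ in RHS]/(_ * _) minkZl minkZr.
by rewrite /mink !mxE; ring.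
Unshelve. all: by end_near. Qed.

(** * Arc length *)

Definition speed (R : realType) (L : set R) (c : R -> 'rV[R]_4) (t : R) : R :=
  mink_norm (derive_in L c t).

Lemma spacelike_derive (R : realType) (L : set R) (c : R -> 'rV[R]_4) (s : R) :
  spacelike_curve L c -> L s -> 0 < mink (derive_in L c s) (derive_in L c s).
Proof.
by case=> _ _ csp /csp [[//|->]]; rewrite eqxx.
Qed.

Lemma speed_gt0 (R : realType) (L : set R) (c : R -> 'rV[R]_4) (s : R) :
  spacelike_curve L c -> L s -> 0 < speed L c s.
Proof.
by move=> csp Ls; rewrite sqrtr_gt0 normr_gt0 gt_eqF// spacelike_derive.
Qed.

Lemma speed_continuous (R : realType) (L : set R) (c : R -> 'rV[R]_4) :
  smooth_on L c -> {within L, continuous (speed L c)}.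
Proof.
move=> csm.
have /subspace_continuousP dc : {within L, continuous (derive_in L c)}.
  by apply: derivable_in_continuous => s Ls; exact: (csm 1%N).
apply/subspace_continuousP => s Ls.
have ds : derive_in L c t @[t --> within L (nbhs s)] --> derive_in L c s.
  exact: dc.
exact: (cvg_comp _ Num.sqrt (cvg_norm (cvg_mink ds ds)) (@sqrt_continuous R _)).
Qed.

Lemma sub_interval (R : realType) (L : set R) (a b : R) :
  is_interval L -> L a -> L b -> `[a, b] `<=` L.
Proof. by move=> Li La Lb x; rewrite /= in_itv/= => /(Li _ _ La Lb). Qed.

Lemma speed_integrable (R : realType) (L : set R) (c : R -> 'rV[R]_4)
    (a b : R) :
  spacelike_curve L c -> L a -> L b ->
  lebesgue_measure.-integrable `[a, b] (EFin \o speed L c).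
Proof.
move=> [[Li _] csm _] La Lb; apply: continuous_compact_integrable.
  exact: segment_compact.
apply: continuous_subspaceW (speed_continuous csm); exact: sub_interval.
Qed.

Lemma integral_speed_split (R : realType) (L : set R) (c : R -> 'rV[R]_4)
    (a x b : R) :
  spacelike_curve L c -> L a -> L b -> a <= x <= b ->
  \int[lebesgue_measure]_(t in `[a, b]) speed L c t =
  \int[lebesgue_measure]_(t in `[a, x]) speed L c t +
  \int[lebesgue_measure]_(t in `[x, b]) speed L c t.
Proof.
move=> csp La Lb axb; have [ax xb] := andP axb.
have Lx : L x by case: (csp) => -[Li _] _ _; exact: Li axb.
rewrite -[X in _ = _ + X]Rintegral_itv_obnd_cbnd.
  have := @Rintegral_itvB _ (speed L c) (BLeft a) (BRight b) x
    (speed_integrable csp La Lb).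
  by rewrite !bnd_simp => /(_ ax xb) <-; rewrite addrC subrK.
apply: (integrableS _ _ _ (speed_integrable csp Lx Lb)) => //.
exact: subset_itv_oc_cc.
Qed.

(** The choice of the origin s0 disappears in differences, whatever its
    position relative to a and b. *)
Lemma arc_lengthB (R : realType) (L : set R) (c : R -> 'rV[R]_4)
    (s0 a b : R) :
  spacelike_curve L c -> L s0 -> L a -> L b -> a <= b ->
  arc_length L c s0 b - arc_length L c s0 a =
  \int[lebesgue_measure]_(t in `[a, b]) speed L c t.
Proof.
move=> csp L0 La Lb ab; rewrite /arc_length -/(speed L c).
have [sa|sa] := leP s0 a.
  rewrite (le_trans sa ab) (@integral_speed_split _ _ _ s0 a b) ?sa//.
  by rewrite addrC addKr.
have [sb|sb] := leP s0 b.
  by rewrite opprK addrC -(@integral_speed_split _ _ _ a s0 b) ?(ltW sa).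
rewrite opprK (@integral_speed_split _ _ _ a b s0) ?ab ?(ltW sb)//.
by rewrite addrC addrK.
Qed.

Lemma arc_lengthB_bounds (R : realType) (L : set R) (c : R -> 'rV[R]_4)
    (s0 a b m M : R) :
  spacelike_curve L c -> L s0 -> L a -> L b -> a <= b ->
  (forall t, a <= t <= b -> m <= speed L c t <= M) ->
  m * (b - a) <= arc_length L c s0 b - arc_length L c s0 a <= M * (b - a).
Proof.
move=> csp L0 La Lb ab vmM; rewrite arc_lengthB//.
have cstE r : r * (b - a) = \int[lebesgue_measure]_(t in `[a, b]) (cst r t).
  rewrite Rintegral_cst//= lebesgue_measure_itv/= lte_fin.
  by case: ltgtP ab => // -> _; rewrite subrr.
have csti r : lebesgue_measure.-integrable `[a, b] (EFin \o (@cst R R r)).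
  apply: continuous_compact_integrable; first exact: segment_compact.
  by apply: continuous_subspaceT => x; exact: cvg_cst.
have vi := speed_integrable csp La Lb.
by rewrite !cstE; apply/andP; split; apply: le_Rintegral => // t /=;
  rewrite in_itv/= => /vmM /andP[].
Qed.

(** On the compact segment [a, b] the continuous speed attains a minimum, which
    is positive and bounds the increment below through
    [arc_lengthB_bounds]. *)
Lemma arc_length_lt (R : realType) (L : set R) (c : R -> 'rV[R]_4)
    (s0 a b : R) :
  spacelike_curve L c -> L s0 -> L a -> L b -> a < b ->
  arc_length L c s0 a < arc_length L c s0 b.
Proof.
move=> csp L0 La Lb ab; case: (csp) => -[Li _] csm _.
have vc : {within `[a, b], continuous (speed L c)}.
  by apply: continuous_subspaceW (speed_continuous csm); exact: sub_interval.
have [x xab vx] := EVT_min (ltW ab) vc.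
have [y yab vy] := EVT_max (ltW ab) vc.
have /andP[+ _] : speed L c x * (b - a) <=
    arc_length L c s0 b - arc_length L c s0 a <= speed L c y * (b - a).
  apply: arc_lengthB_bounds => //; first exact: ltW.
  by move=> t tab; rewrite vx ?vy// in_itv.
rewrite -subr_gt0; apply: lt_le_trans.
rewrite mulr_gt0 ?subr_gt0//; apply: speed_gt0 csp _.
exact: (sub_interval Li La Lb).
Qed.

Lemma arc_length_inj (R : realType) (L : set R) (c : R -> 'rV[R]_4)
    (s0 a b : R) :
  spacelike_curve L c -> L s0 -> L a -> L b -> a != b ->
  arc_length L c s0 a != arc_length L c s0 b.
Proof.
move=> csp L0 La Lb; case: (ltgtP a b) => // h _.
  by rewrite lt_eqF// arc_length_lt.
by rewrite gt_eqF// arc_length_lt.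
Qed.

(** The fundamental theorem of calculus, one-sided at endpoints of L: where the
    speed is within e of its value at s, [arc_lengthB_bounds] confines the
    difference quotient to the same range. *)
Lemma has_derive_in_arc_length (R : realType) (L : set R)
    (c : R -> 'rV[R]_4) (s0 s : R) :
  spacelike_curve L c -> L s0 -> L s ->
  has_derive_in L (arc_length L c s0 : R -> R^o) s (speed L c s).
Proof.
move=> csp L0 Ls; case: (csp) => -[Li _] csm _.
have /subspace_continuousP/(_ s Ls) vc := speed_continuous csm.
apply/cvgrPdist_le => e e0.
have /nbhs_ballP[d /= d0 dv] : nbhs s [set t | L t ->
    `|speed L c s - speed L c t| <= e].
  by move/cvgrPdist_le : vc => /(_ e e0).
have : nbhs s (ball s d) by exact: nbhsx_ballx.
apply: filterS => t std /= ts Lt.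
rewrite /diff_quotient -[_ *: _]/(_ * _).
have vst x : (s <= x <= t) || (t <= x <= s) ->
    speed L c s - e <= speed L c x <= speed L c s + e.
  move=> xst; rewrite -ler_distlC; apply: dv.
    by move: std xst; rewrite /ball/= !ltr_distlC; lra.
  by case/orP : xst; exact: Li.
have ts0 : 0 < `|t - s| by rewrite normr_gt0 subr_eq0.
rewrite -(ler_pM2r ts0) -normrM mulrBl mulrAC mulVf ?subr_eq0// mul1r.
case: (ltgtP t s) ts => // ts _.
- have := @arc_lengthB_bounds _ _ c s0 t s _ _ csp L0 Lt Ls (ltW ts)
    (fun x tx => vst x (introT orP (or_intror tx))).
  rewrite ler_norml ltr0_norm ?subr_lt0//; lra.
- have := @arc_lengthB_bounds _ _ c s0 s t _ _ csp L0 Ls Lt (ltW ts)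
    (fun x tx => vst x (introT orP (or_introl tx))).
  rewrite ler_norml gtr0_norm ?subr_gt0//; lra.
Qed.

(** * Frenet frames *)

(** The value of <e3, e3> is written as mu1 mu2 so that the three causal types
    can be treated by one computation. *)
Lemma frame_products (R : realType) (C : frenet_data R) (s : R) :
  special_frenet C -> domain C s ->
  [/\ mink (e1 C s) (e1 C s) = 1,
      mink (e3 C s) (e3 C s) = mu1 R (causal C) * mu2 R (causal C),
      mink (e1 C s) (e2 C s) = 0, mink (e1 C s) (e3 C s) = 0 &
      mink (e2 C s) (e3 C s) = 0].
Proof.
move=> hC Ls; have orth := sf_orthonormal hC Ls; split.
- by rewrite (orth 0 0) /frame_sign; case: (causal C).
- by rewrite (orth 2 2) /frame_sign; case: (causal C) => /=; ring.
- exact: (orth 0 1).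
- exact: (orth 0 2).
- exact: (orth 1 2).
Qed.

(** The frame is a basis, because its determinant is nonzero; the coordinates
    of v along e1 and e2 are, up to sign, its products with these vectors. *)
Lemma orthogonal_e1_e2_span (R : realType) (C : frenet_data R) (s : R)
    (v : 'rV[R]_4) :
  special_frenet C -> domain C s ->
  mink v (e1 C s) = 0 -> mink v (e2 C s) = 0 ->
  exists a b : R, v = a *: e3 C s + b *: e4 C s.
Proof.
move=> hC Ls v1 v2; have orth := sf_orthonormal hC Ls.
pose M := \matrix_(i < 4) tnth (frame C s) i.
have Mu : M \in unitmx by rewrite unitmxE (sf_oriented hC Ls) unitr1.
pose a := v *m invmx M.
have vE : v = a 0 0 *: e1 C s + a 0 1 *: e2 C s +
              a 0 2 *: e3 C s + a 0 3 *: e4 C s.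
  rewrite -[LHS](mulmxKV Mu) mulmx_sum_row !big_ord_recl big_ord0 addr0 !rowK.
  rewrite !addrA; congr (_ *: _ + _ *: _ + _ *: _ + _ *: _);
    by congr (a 0 _); apply: val_inj.
have sgn_neq0 i : frame_sign R (causal C) i != 0.
  by rewrite /frame_sign; case: ifP; rewrite ?oppr_eq0 oner_eq0.
have a0 : a 0 0 = 0.
  move: v1; rewrite vE !minkDl !minkZl.
  rewrite (orth 0 0) (orth 1 0) (orth 2 0) (orth 3 0) /= !mulr0 !addr0.
  by move/eqP; rewrite mulf_eq0 (negPf (sgn_neq0 _)) orbF => /eqP.
have a1 : a 0 1 = 0.
  move: v2; rewrite vE !minkDl !minkZl.
  rewrite (orth 0 1) (orth 1 1) (orth 2 1) (orth 3 1) /= !mulr0 !addr0 add0r.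
  by move/eqP; rewrite mulf_eq0 (negPf (sgn_neq0 _)) orbF => /eqP.
exists (a 0 2), (a 0 3).
by rewrite {1}vE a0 a1 !scale0r !add0r.
Qed.

(** * The mate curve *)

(** By the second Frenet formula e2' has no component along e2, which is what
    makes e1* orthogonal to e2. *)
Lemma has_derive_in_mate (R : realType) (C : frenet_data R) (alpha : R)
    (cstar : R -> 'rV[R]_4) (s : R) :
  special_frenet C ->
  (forall s, domain C s -> cstar s = curve C s + alpha *: e2 C s) ->
  domain C s ->
  has_derive_in (domain C) cstar s
    ((1 + alpha * mu1 R (causal C) * k1 C s) *: e1 C s +
     (alpha * k2 C s) *: e3 C s).
Proof.
move=> hC cE Ls; have [_ csm _] := sf_curve hC.
have [_ e2sm _ _] := sf_smooth_frame hC.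
have := has_derive_inDZ (a := alpha) (derivable_inP (csm 0%N s Ls))
                              (derivable_inP (e2sm 0%N s Ls)).
rewrite /= -(sf_tangent hC Ls) (sf_frenet2 hC Ls) scalerDr !scalerA addrA.
rewrite -[X in X + _ + _]scale1r -scalerDl mulrA.
by apply: eq_has_derive_in => // t /cE.
Qed.

(** The chain rule for c = curve D o f, where the arc length f of c has
    derivative [speed L c]. *)
Lemma reparam_tangent (R : realType) (L : set R) (c : R -> 'rV[R]_4)
    (s0 s : R) (D : frenet_data R) :
  spacelike_curve L c -> L s0 -> L s ->
  arc_length_form L c s0 D -> special_frenet D ->
  speed L c s *: e1 D (arc_length L c s0 s) = derive_in L c s.
Proof.
move=> csp L0 Ls [domD curD] hD; have [Lnd csm _] := csp.
have Dfs : domain D (arc_length L c s0 s) by rewrite domD; exists s.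
rewrite (sf_tangent hD Dfs).
have [_ Dsm _] := sf_curve hD.
apply: (has_derive_in_unique Lnd Ls _ (derivable_inP (csm 0%N s Ls))).
apply: (eq_has_derive_in Ls curD).
apply: (has_derive_in_comp Ls _ (has_derive_in_arc_length csp L0 Ls)).
  by move=> t Lt ts; exact: arc_length_inj.
by rewrite -domD; exact: derivable_inP (Dsm 0%N _ Dfs).
Qed.

Lemma reparam_frenet1 (R : realType) (L : set R) (c : R -> 'rV[R]_4)
    (s0 s : R) (D : frenet_data R) :
  spacelike_curve L c -> L s0 -> L s ->
  arc_length_form L c s0 D -> special_frenet D ->
  has_derive_in L (e1 D \o arc_length L c s0) s
    ((speed L c s * k1 D (arc_length L c s0 s)) *: e2 D (arc_length L c s0 s)).
Proof.
move=> csp L0 Ls [domD curD] hD; have [Lnd csm _] := csp.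
have Dfs : domain D (arc_length L c s0 s) by rewrite domD; exists s.
have [e1sm _ _ _] := sf_smooth_frame hD.
rewrite -scalerA -(sf_frenet1 hD Dfs).
apply: (has_derive_in_comp Ls _ (has_derive_in_arc_length csp L0 Ls)).
  by move=> t Lt ts; exact: arc_length_inj.
by rewrite -domD; exact: derivable_inP (e1sm 0%N _ Dfs).
Qed.

Theorem theorem3p2 (R : realType) (C : frenet_data R) (alpha : R)
    (hC : special_frenet C)
    (hk1 : ~ constant_on (domain C) (k1 C))
    (hk2 : ~ constant_on (domain C) (k2 C))
    (halpha : alpha != 0)
    (hk : forall s, domain C s ->
      k1 C s = - alpha * (mu1 R (causal C) * k1 C s ^+ 2
                          + mu2 R (causal C) * k2 C s ^+ 2))
    (cstar : R -> 'rV[R]_4)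
    (hcstar : forall s, domain C s -> cstar s = curve C s + alpha *: e2 C s)
    (hspace : spacelike_curve (domain C) cstar)
    (s0 : R) (hs0 : domain C s0)
    (Cstar : frenet_data R)
    (hform : arc_length_form (domain C) cstar s0 Cstar)
    (hCstar : special_frenet Cstar) :
  generalized_mannheim_mate C Cstar (arc_length (domain C) cstar s0).
Proof.
set L := domain C; set f := arc_length L cstar s0.
have [domE curE] := hform; have [Lnd csm _] := hspace.
split=> //.
  rewrite domE; split; [by move=> t Lt; exists t| |exact: subset_refl].
  move=> s t; rewrite !inE => Ls Lt /eqP fst; apply/eqP.
  by apply: contraLR fst; exact: arc_length_inj.
have [_ e2sm _ _] := sf_smooth_frame hC.
have vel s : L s -> speed L cstar s *: e1 Cstar (f s) =
    (1 + alpha * mu1 R (causal C) * k1 C s) *: e1 C s +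
    (alpha * k2 C s) *: e3 C s.
  move=> Ls; rewrite (reparam_tangent hspace hs0 Ls hform hCstar).
  apply: (has_derive_in_unique Lnd Ls (derivable_inP (csm 0%N s Ls))).
  exact: has_derive_in_mate.
have e1_orth s : L s -> mink (e1 Cstar (f s)) (e2 C s) = 0.
  move=> Ls; have v0 := speed_gt0 hspace Ls.
  apply: (mulfI (lt0r_neq0 v0)); rewrite -minkZl vel// minkDl !minkZl.
  by have [_ _ -> _ e23] := frame_products hC Ls; rewrite minkC e23; ring.
have e2_orth s : L s -> mink (e2 Cstar (f s)) (e2 C s) = 0.
  move=> Ls; have v0 := speed_gt0 hspace Ls.
  have Dfs : domain Cstar (f s) by rewrite domE; exists s.
  have [k1s _ _] := sf_curvatures hCstar Dfs.
  (* the product <e1* o f, e2> has two derivatives: the one given by the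
     product rule and, being identically zero on L, zero *)
  have d := has_derive_in_mink (reparam_frenet1 hspace hs0 Ls hform hCstar)
    (derivable_inP (e2sm 0%N s Ls)).
  have d0 : has_derive_in L
      (fun t => mink (e1 Cstar (f t)) (e2 C t) : R^o) s 0.
    apply: (@eq_has_derive_in _ _ _ (cst 0)) => //.
      by move=> t /e1_orth ->.
    rewrite /has_derive_in /diff_quotient; under eq_fun do rewrite subrr scaler0.
    exact: cvg_cst.
  have {d d0} := has_derive_in_unique Lnd Ls d d0.
  rewrite /= (sf_frenet2 hC Ls) minkZl.
  have -> : mink (e1 Cstar (f s))
      ((mu1 R (causal C) * k1 C s) *: e1 C s + k2 C s *: e3 C s) = 0.
    apply: (mulfI (lt0r_neq0 v0)); rewrite -minkZl vel// !minkDl !minkDr.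
    rewrite !minkZl !minkZr [mink (e3 _ _) (e1 _ _)]minkC.
    have [-> -> _ -> _] := frame_products hC Ls.
    (* up to the factor mu1, the left-hand side is the difference of the two
       sides of the relation between k1 and k2 *)
    have := hk s Ls; case: (causal C) => /=; lra.
  rewrite addr0 => /eqP; rewrite mulf_eq0 => /orP[|/eqP//].
  by rewrite gt_eqF// mulr_gt0.
move=> s Ls x [t ->].
have Dfs : domain Cstar (f s) by rewrite domE; exists s.
have [] := @orthogonal_e1_e2_span _ Cstar (f s) (e2 C s) hCstar Dfs.
- by rewrite minkC e1_orth.
- by rewrite minkC e2_orth.
move=> a [b e2E].
(* c + t e2 = c* + (t - alpha) e2 *)
exists ((t - alpha) * a), ((t - alpha) * b).
rewrite curE// hcstar// -!scalerA -!addrA -scalerDr -e2E -scalerDl.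
by rewrite [_ + (_ - _)]addrC subrK.
Qed.
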